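(* The bivariate $f$-polynomial of the family of twisted path hypercube graph associahedra is \[ f^{TP}(x,y)=\left(1+\frac{xy}{(1-xy)(1+yf^A)-2yf^A}+yf^A(f^C-1)\right)\left(1+y\left[(2+yD_y)f^A\right]\right), \] where $f^A$ is the bivariate $f$-polynomial of the family of associahedra, $f^C$ is the bivariate $f$-polynomial of the family of cis double path graphs, and $D_y=\partial/\partial y$. The generating function for the number of vertices of the $n$-dimensional twisted path hypercube graph associahedron is \[ f^{TP}(0,y)=\frac{1-2y+\sqrt{1-4y}}{2(1-4y)} . \]
   Context: For a family of $n$-dimensional polytopes $P_n$, $n\ge0$ ($P_0$ a point), the bivariate $f$-polynomial is $\sum_{n,k\ge0}f_k(P_n)x^ky^n$, with $f_k(P_n)$ the number of $k$-dimensional faces. Identities are of formal power series; square roots have constant term $1$. Let $\pm[n]=\{-n,\dots,-1,1,\dots,n\}$. For a graph on a subset of $\pm[n]$, a tube is a nonempty set of vertices inducing a connected subgraph and containing no pair $\{i,-i\}$. Two tubes are weakly compatible if one is contained in the other, or they are disjoint with no edge between them. A tubing is a set of pairwise weakly compatible tubes whose union contains no pair $\{i,-i\}$. The hypercube graph associahedron of a graph on $\pm[n]$ is the simple $n$-dimensional polytope whose dual simplicial complex is isomorphic to the complex of tubings (so $k$-dimensional faces correspond to tubings with $n-k$ tubes). The twisted path graph is the path along the vertices $(1,2,\dots,n,-1,-2,\dots,-n)$ in $\pm[n]$ (consecutive vertices are adjacent; for $n=1$ the pair $\{1,-1\}$ plays no role as an edge). The cis double path graph $C_n$, $n\ge1$,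 is the graph on $\pm[n]\setminus\{-1,-n\}$ induced from the double path graph, which has edges $\{i,i+1\}$ and $\{-i,-(i+1)\}$, $1\le i<n$. Its bivariate $f$-polynomial is $f^C=1+\sum_{n\ge1}\sum_{k}c_{n,k}x^{n-k}y^n$, where $c_{n,k}$ is the number of tubings of $C_n$ with $k$ tubes (this is the count of $(n-k)$-dimensional faces of the corresponding pointed $n$-dimensional simple polyhedron). The $n$-dimensional associahedron is the simple polytope whose $(n-k)$-dimensional faces correspond to sets of $k$ pairwise compatible tubes of the path on $n+1$ vertices, where here a tube is a nonempty proper vertex subset inducing a connected subgraph, and two tubes are compatible if one contains the other or they are disjoint and non-adjacent (equivalently, sets of $k$ pairwise noncrossing diagonals of an $(n+3)$-gon). *)

(* Defs.v *)
From HB Require Import structures.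
From mathcomp Require Import all_boot all_order all_algebra.
From mathcomp Require Import boolp.

Set Implicit Arguments.
Unset Strict Implicit.
Unset Printing Implicit Defensive.

Import GRing.Theory.
Local Open Scope ring_scope.

Record fps (R : Type) := Fps { coefs : nat -> R }.

HB.instance Definition _ (R : Type) := gen_eqMixin (fps R).
HB.instance Definition _ (R : Type) := gen_choiceMixin (fps R).

Lemma fpsP (R : Type) (f g : fps R) : coefs f =1 coefs g -> f = g.
Proof. by case: f g => [f] [g] /= /funext ->. Qed.

Section FpsZmodule.
Variable R : zmodType.

Definition fps_zero : fps R := Fps (fun=> 0).
Definition fps_opp (f : fps R) := Fps (fun n => - coefs f n).
Definition fps_add (f g : fps R) := Fps (fun n => coefs f n + coefs g n).

Fact fps_addA : associative fps_add.
Proof. by move=> f g h; apply: fpsP => n /=; rewrite addrA. Qed.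
Fact fps_addC : commutative fps_add.
Proof. by move=> f g; apply: fpsP => n /=; rewrite addrC. Qed.
Fact fps_add0 : left_id fps_zero fps_add.
Proof. by move=> f; apply: fpsP => n /=; rewrite add0r. Qed.
Fact fps_addN : left_inverse fps_zero fps_opp fps_add.
Proof. by move=> f; apply: fpsP => n /=; rewrite addNr. Qed.

HB.instance Definition _ :=
  GRing.isZmodule.Build (fps R) fps_addA fps_addC fps_add0 fps_addN.

Lemma coefs0 n : coefs (0 : fps R) n = 0. Proof. by []. Qed.
Lemma coefsN (f : fps R) n : coefs (- f) n = - coefs f n. Proof. by []. Qed.
Lemma coefsD (f g : fps R) n : coefs (f + g) n = coefs f n + coefs g n.
Proof. by []. Qed.
End FpsZmodule.

Section FpsRing.
Variable R : comNzRingType.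
Implicit Types f g h : fps R.

Definition fpsC (c : R) : fps R := Fps (fun n => if n == 0%N then c else 0).
Definition fpsX : fps R := Fps (fun n => (n == 1%N)%:R).
Definition fps_mul f g : fps R :=
  Fps (fun n => \sum_(j < n.+1) coefs f j * coefs g (n - j)).

Definition fps_trunc n f : {poly R} := \poly_(i < n.+1) coefs f i.

Lemma coefs_mul_trunc m f g n : (n <= m)%N ->
  coefs (fps_mul f g) n = (fps_trunc m f * fps_trunc m g)`_n.
Proof.
move=> nm; rewrite coefM /=; apply: eq_bigr => j _.
have jn : (j <= n)%N by rewrite -ltnS.
by rewrite !coef_poly !ltnS (leq_trans jn nm) (leq_trans (leq_subr j n) nm).
Qed.

Fact fps_mulC : commutative fps_mul.
Proof.
by move=> f g; apply: fpsP => n; rewrite !(coefs_mul_trunc _ _ (leqnn n)) mulrC.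
Qed.

Lemma coefs_mul3 f g h n : coefs (fps_mul f (fps_mul g h)) n =
  (fps_trunc n f * (fps_trunc n g * fps_trunc n h))`_n.
Proof.
rewrite coefM /=; apply: eq_bigr => j _; rewrite coef_poly ltn_ord.
by rewrite -(coefs_mul_trunc _ _ (leq_subr j n)).
Qed.

Fact fps_mulA : associative fps_mul.
Proof.
move=> f g h; apply: fpsP => n.
by rewrite (fps_mulC (fps_mul f g)) !coefs_mul3 mulrA [in LHS]mulrC.
Qed.
Fact fps_mul1 : left_id (fpsC 1) fps_mul.
Proof.
move=> f; apply: fpsP => n /=; rewrite big_ord_recl /= mul1r subn0 big1 ?addr0//.
by move=> i _; rewrite mul0r.
Qed.
Fact fps_mulD : left_distributive fps_mul (@fps_add R).
Proof.
move=> f g h; apply: fpsP => n /=; rewrite -big_split /=.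
by apply: eq_bigr => i _; rewrite mulrDl.
Qed.
Fact fps_one_neq0 : fpsC 1 != 0.
Proof. by apply/eqP => /(congr1 (fun f => coefs f 0)) /eqP; rewrite /= oner_eq0. Qed.

HB.instance Definition _ := GRing.Zmodule_isComNzRing.Build (fps R)
  fps_mulA fps_mulC fps_mul1 fps_mulD fps_one_neq0.

Lemma coefs1 n : coefs (1 : fps R) n = if n == 0%N then 1 else 0.
Proof. by []. Qed.
Lemma coefsM f g n :
  coefs (f * g) n = \sum_(j < n.+1) coefs f j * coefs g (n - j).
Proof. by []. Qed.
Lemma coefsM0 f g : coefs (f * g) 0 = coefs f 0 * coefs g 0.
Proof. by rewrite coefsM big_ord1. Qed.

Definition fps_deriv f : fps R := Fps (fun n => coefs f n.+1 *+ n.+1).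
End FpsRing.

Arguments fpsX {R}.

(** [fps_rec F] is the series whose coefficient of degree n is [F] applied to
    the list of its coefficients of degree less than n. *)
Section FpsRec.
Variables (R : nmodType) (F : seq R -> R).

Fixpoint fps_prefix n : seq R :=
  if n is m.+1 then rcons (fps_prefix m) (F (fps_prefix m)) else [::].
Definition fps_rec : fps R := Fps (fun n => F (fps_prefix n)).

Lemma fps_prefixE n : fps_prefix n = mkseq (coefs fps_rec) n.
Proof. by elim: n => //= n IHn; rewrite mkseqS /= -IHn. Qed.
Lemma coefs_rec n : coefs fps_rec n = F (mkseq (coefs fps_rec) n).
Proof. by rewrite /= -fps_prefixE. Qed.
End FpsRec.

Section FpsUnit.
Variable R : comUnitRingType.
Implicit Types f g : fps R.

Definition fps_unit : {pred fps R} := [pred f | coefs f 0 \is a GRing.unit].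
Definition fps_inv f : fps R :=
  if f \in fps_unit then
    fps_rec (fun s => if s is [::] then (coefs f 0)^-1 else
      - (coefs f 0)^-1 * \sum_(j < size s) s`_j * coefs f (size s - j))
  else f.

Fact fps_mulV : {in fps_unit, left_inverse 1 fps_inv *%R}.
Proof.
move=> f fU; rewrite /fps_inv fU; have f0U : coefs f 0 \is a GRing.unit by [].
set g := fps_rec _; apply: fpsP => -[|n].
  by rewrite coefsM0 /= mulVr.
rewrite coefsM big_ord_recr /= subnn -[F in _ + F * _]/(coefs g n.+1) coefs_rec.
rewrite -/g mulNr mulNr mulrAC mulVr// mul1r.
case E: (mkseq _ _) => [|a s]; first by move/(congr1 size): E; rewrite size_mkseq.
rewrite -E size_mkseq; apply/eqP; rewrite subr_eq0; apply/eqP.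
by apply: eq_bigr => j _; rewrite nth_mkseq.
Qed.

Fact fps_unitPl f g : g * f = 1 -> f \in fps_unit.
Proof.
move=> /(congr1 (fun h => coefs h 0)); rewrite coefsM0 coefs1 /= => gf1.
by apply/unitrPr; exists (coefs g 0); rewrite mulrC.
Qed.

Fact fps_inv_out : {in [predC fps_unit], fps_inv =1 id}.
Proof. by move=> f; rewrite inE /= /fps_inv => /negbTE ->. Qed.

HB.instance Definition _ := GRing.ComNzRing_hasMulInverse.Build (fps R)
  fps_mulV fps_unitPl fps_inv_out.

Lemma fps_unitE f : (f \is a GRing.unit) = (coefs f 0 \is a GRing.unit).
Proof. by []. Qed.
End FpsUnit.

(** The square root with constant term 1 of a series with constant term 1. *)
Definition fps_sqrt (f : fps rat) : fps rat :=
  fps_rec (fun s => if s is [::] then 1 else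
    (coefs f (size s) - \sum_(1 <= j < size s) s`_j * s`_(size s - j)) / 2).

Lemma fps_sqrt0 f : coefs (fps_sqrt f) 0 = 1.
Proof. by []. Qed.

Lemma fps_sqrtS f n (g := fps_sqrt f) : coefs g n.+1 =
  (coefs f n.+1 - \sum_(i < n) coefs g i.+1 * coefs g (n - i)) / 2.
Proof.
rewrite {1}/g /fps_sqrt coefs_rec -/(fps_sqrt f) -/g.
case E: (mkseq _ _) => [|a s]; first by move/(congr1 size): E; rewrite size_mkseq.
rewrite -E size_mkseq big_add1 big_mkord; congr ((_ - _) / _).
by apply: eq_bigr => i _; rewrite subSS !nth_mkseq// ltnS ?leq_subr// ltnW.
Qed.

Lemma fps_sqrtK f : coefs f 0 = 1 -> fps_sqrt f ^+ 2 = f.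
Proof.
move=> f0; apply: fpsP => n; move: (fps_sqrt0 f) (@fps_sqrtS f).
move: (fps_sqrt f) => g g0 gS; rewrite expr2; case: n => [|n].
  by rewrite coefsM0 g0 f0 mulr1.
rewrite coefsM big_ord_recr big_ord_recl /= subnn subn0 g0 mul1r mulr1 addrAC.
rewrite -mulr2n -mulr_natr {1}gS divfK//.
by rewrite -[RHS](subrK (\sum_(i < n) coefs g i.+1 * coefs g (n - i))).
Qed.

Lemma fps_sqrt_unique f g : g ^+ 2 = f -> coefs g 0 = 1 -> g = fps_sqrt f.
Proof.
move=> gf g0; have f0 : coefs f 0 = 1 by rewrite -gf expr2 coefsM0 g0 mulr1.
have /eqP : (g - fps_sqrt f) * (g + fps_sqrt f) = 0.
  by rewrite -subr_sqr gf fps_sqrtK// subrr.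
have sU : g + fps_sqrt f \is a GRing.unit by rewrite fps_unitE coefsD g0 fps_sqrt0.
by rewrite -[X in _ == X](mul0r (g + fps_sqrt f)) (can_eq (mulrK sU)) subr_eq0 => /eqP.
Qed.

(** Bivariate series: Q[[x, y]] is represented as Q[[x]][[y]], so the
    coefficient of x^k y^n in f is [coefs (coefs f n) k], and [fps_deriv] is
    the derivative with respect to y. *)
Notation fps2 := (fps (fps rat)).
Definition varx : fps2 := fpsC fpsX.
Definition vary : fps2 := fpsX.
Definition at_x0 (f : fps2) : fps rat := Fps (fun n => coefs (coefs f n) 0).

(** The bivariate f-polynomial of a family with [F n k] faces of dimension k
    in its n-dimensional member. *)
Definition bivariate_fpoly (F : nat -> nat -> nat) : fps2 :=
  Fps (fun n => Fps (fun k => (F n k)%:R)).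

(** Number of k-dimensional faces of a simple n-dimensional polytope with dual
    simplicial complex K (given as its set of simplices, set0 included): such
    faces are dual to the simplices with n - k vertices. *)
Definition simple_face_num (U : finType) (K : {set {set U}}) (n k : nat) : nat :=
  #|[set X in K | (#|X| + k == n)%N]|.

Section Graph.
Variables (T : finType) (e : rel T).

Definition induced (S : {set T}) : rel T :=
  [rel u v | [&& u \in S, v \in S & e u v]].

Definition connected_in (S : {set T}) : bool :=
  [forall u in S, forall v in S, connect (induced S) u v].

Definition weakly_compatible (S S' : {set T}) : bool :=
  [|| S \subset S', S' \subset S |
      [disjoint S & S'] && [forall u in S, forall v in S', ~~ e u v]].
End Graph.

Definition consecutive (i j : nat) : bool := (i.+1 == j) || (j.+1 == i).

Definition path_adj (m : nat) : rel 'I_m := [rel i j : 'I_m | consecutive i j].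

Definition path_tube (m : nat) (S : {set 'I_m}) : bool :=
  [&& S != set0, S \proper [set: 'I_m] & connected_in (@path_adj m) S].

Definition path_tubings (m : nat) : {set {set {set 'I_m}}} :=
  [set X : {set {set 'I_m}} | [forall S in X, path_tube S] &&
           [forall S in X, forall S' in X, weakly_compatible (@path_adj m) S S']].

Definition fA : fps2 :=
  bivariate_fpoly (fun n => simple_face_num (path_tubings n.+1) n).

(** The vertices 1, ..., n, -1, ..., -n: the pair (i, false) stands for i + 1
    and (i, true) for -(i + 1). *)
Definition pm (n : nat) : finType := ('I_n * bool)%type.

Definition pm_opp (n : nat) (v : pm n) : pm n := (v.1, ~~ v.2).

Definition no_opposite (n : nat) (S : {set pm n}) : bool :=
  [forall v in S, pm_opp v \notin S].

Section Hypercube.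
Variables (n : nat) (V : {set pm n}) (e : rel (pm n)).

Definition tube (S : {set pm n}) : bool :=
  [&& S != set0, S \subset V, connected_in e S & no_opposite S].

Definition tubings : {set {set {set pm n}}} :=
  [set X : {set {set pm n}} | [&& [forall S in X, tube S],
               [forall S in X, forall S' in X, weakly_compatible e S S']
             & no_opposite (cover X)]].
End Hypercube.

(** Position (from 0) in the sequence 1, ..., n, -1, ..., -n. *)
Definition twisted_pos (n : nat) (v : pm n) : nat := if v.2 then (n + v.1)%N else v.1.

(** For n = 1 this makes 1 and -1 adjacent, which affects no tubing since no
    tubing contains both in its union. *)
Definition twisted_path (n : nat) : rel (pm n) :=
  [rel u v : pm n | consecutive (twisted_pos u) (twisted_pos v)].

Definition double_path (n : nat) : rel (pm n) :=
  [rel u v : pm n | (u.2 == v.2) && consecutive u.1 v.1].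

(** All vertices but -1 and -n. *)
Definition cis_vertices (n : nat) : {set pm n} :=
  [set v : pm n | ~~ (v.2 && ((v.1 == 0%N :> nat) || (v.1.+1 == n)))].

Definition fTP : fps2 :=
  bivariate_fpoly (fun n =>
    simple_face_num (tubings [set: pm n] (@twisted_path n)) n).

Definition fC : fps2 :=
  1 + bivariate_fpoly (fun n k =>
    if n is 0 then 0%N
    else simple_face_num (tubings (cis_vertices n) (@double_path n)) n k).

(** The inverse of a non-unit is a junk value; the two series by which one
    divides in the generating function identities are units. *)
Lemma fTP_denominator_unit :
  (1 - varx * vary) * (1 + vary * fA) - 2 * vary * fA \is a GRing.unit.
Proof.
rewrite fps_unitE !(coefsD, coefsN, coefsM0, coefs1) /=.
by rewrite !(mulr0, mul0r, subr0, addr0, mulr1) unitr1.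
Qed.

Lemma vertex_denominator_unit : 2 * (1 - 4 * fpsX) \is a @GRing.unit (fps rat).
Proof. by rewrite fps_unitE !(coefsM0, coefsD, coefsN) /= mulr0. Qed.

(* Main.v *)
(** Sort the tubings X by the set U of the vertices that they cover. Then
    |X| <= |U|, because each tube has a vertex lying in no smaller tube, and the
    weight x^(n - |X|) becomes a product: a factor x for each i such that neither
    i nor -i is covered, and for each component of U, a path on m vertices say,
    the coefficient of y^m in B = y fA.

    A set U without opposite vertices is a word w in {0, +, -}^n. In the twisted
    path its components are the maximal runs of signs in w, except that a final +
    run is merged with an initial - run; in the cis double path they are exactly
    the runs. Reading words letter by letter gives linear equations with solution
      fTP (1 + B) D = (y (1 + B))'  and  (fC - 1) (1 + B) D = 1 - D,
    where D = 1 - B - xy (1 + B) is the denominator in the formula for fTP. In the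
    same way, the subsets of a path give B = y (1 + B) (1 + (1 + x) B), which is
    the Catalan equation at x = 0. *)

Require Import Defs.
From mathcomp Require Import all_boot all_order all_algebra.
From mathcomp Require Import ring zify.
Import GRing.Theory.
Local Open Scope ring_scope.

Set Implicit Arguments.
Unset Strict Implicit.
Unset Printing Implicit Defensive.

(** * Nested families of tubes and the weight of the sets they cover *)

Section Nested.
Variables (T : finType) (e : rel T).
Implicit Types (A B S M : {set T}) (X : {set {set T}}).

Definition separated A B := [forall u in A, forall v in B, ~~ e u v].

Lemma separatedP A B :
  reflect {in A & B, forall u v, ~~ e u v} (separated A B).
Proof.
apply: (iffP 'forall_in_forall_inP) => [AB u v uA vB|AB u uA v vB]; exact: AB.
Qed.

(** Trades paths for cuts: a walk leaves M only along an edge from M to the rest of S, and the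
    vertices reachable from u have no edge to the rest. *)
Lemma connected_inP S :
  reflect (forall M, M \subset S -> M != set0 -> separated M (S :\: M) -> M = S)
          (connected_in e S).
Proof.
apply: (iffP 'forall_in_forall_inP) => [Sc M MS /set0Pn[u uM] Msep | Sc u uS v vS].
  apply/eqP; rewrite eqEsubset MS /=; apply/subsetP => v vS.
  have /connectP[p] := Sc u (subsetP MS _ uM) v vS.
  elim: p u uM => [|w p IHp] u uM /=; first by move=> _ ->.
  case/andP=> /and3P[_ wS euw]; apply: IHp; apply: contraLR euw => wM.
  by move/separatedP: Msep; apply; rewrite // inE wM.
have: [set w in S | connect (induced e S) u w] = S.
  apply: Sc; first by apply/subsetP=> w; rewrite inE => /andP[].
    by apply/set0Pn; exists u; rewrite inE uS connect0.
  apply/separatedP => w t; rewrite !inE => /andP[wS uw] /andP[+ tS].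
  rewrite tS /=; apply: contra => ewt; apply: connect_trans uw (connect1 _).
  by rewrite /induced /= wS tS.
by move/setP/(_ v); rewrite inE vS.
Qed.

(** The axioms common to both kinds of tubings; [path_tubingsE] and [tubingsE] add the others. *)
Definition nested X :=
  [forall A in X, (A != set0) && connected_in e A] &&
  [forall A in X, forall B in X, weakly_compatible e A B].

Lemma nestedP X :
  reflect [/\ forall A, A \in X -> A != set0 /\ connected_in e A
            & {in X &, forall A B, weakly_compatible e A B}] (nested X).
Proof.
apply: (iffP andP) => [[/forall_inP Xc /'forall_in_forall_inP Xw]|[Xc Xw]].
  split=> [A /Xc/andP[]//|A B AX BX]; exact: Xw.
split; first by apply/forall_inP=> A /Xc[-> ->].
by apply/'forall_in_forall_inP => A AX B BX; apply: Xw.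
Qed.

Lemma nestedS X X' : X \subset X' -> nested X' -> nested X.
Proof.
move=> /subsetP XX' /nestedP[Xc Xw]; apply/nestedP; split.
  by move=> A /XX'; apply: Xc.
by move=> A B /XX' AX' /XX'; apply: Xw.
Qed.

(** A member M of maximal size has no edge to the rest of the cover: a compatible member that leaves
    M either contains M, against maximality, or is not adjacent to it. *)
Lemma mem_cover_nested X :
  nested X -> cover X != set0 -> connected_in e (cover X) -> cover X \in X.
Proof.
move=> /nestedP[Xc Xw] /set0Pn[u0 /bigcupP[A0 A0X _]] /connected_inP cX.
have [M MX maxM] := @arg_maxnP _ A0 (mem X) (fun A => #|A|) A0X.
suff <- : M = cover X by [].
apply: cX; [exact: bigcup_sup | by have [] := Xc _ MX |].
apply/separatedP => u v uM; rewrite inE => /andP[vM /bigcupP[B BX vB]].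
have /or3P[MB|/subsetP/(_ v vB)|/andP[_ /'forall_in_forall_inP]] := Xw M B MX BX.
- have /eqP defM : M == B by rewrite eqEcard MB; apply: maxM.
  by rewrite defM vB in vM.
- by rewrite (negPf vM).
- by move/(_ u uM v vB).
Qed.

(* Each tube has a vertex which lies in no smaller tube, and these vertices are
   pairwise distinct. *)
Lemma card_nested X : nested X -> (#|X| <= #|cover X|)%N.
Proof.
move=> nX; have [Xc Xw] := nestedP _ nX.
pose below A := [set B in X | B \proper A].
pose own A v := (v \in A) && (v \notin cover (below A)).
have ownP A : A \in X -> exists v, own A v.
  move=> AX; set Y := below A; have [A0 Ac] := Xc A AX.
  have YA : cover Y \subset A.
    by apply/bigcupsP=> B; rewrite inE => /andP[_ /proper_sub].
  (* If the members strictly inside A covered A, [mem_cover_nested] would put A strictly inside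
     itself. *)
  have: ~~ (A \subset cover Y).
    apply/negP => AY; have defA : cover Y = A by apply/eqP; rewrite eqEsubset YA.
    have: cover Y \in Y.
      apply: mem_cover_nested; rewrite ?defA //.
      by apply: nestedS nX; apply/subsetP=> B; rewrite inE => /andP[].
    by rewrite defA inE properxx andbF.
  by case/subsetPn=> v vA vY; exists v; rewrite /own vA.
case: (set_0Vmem X) => [->|[A1 A1X]]; first by rewrite cards0.
have [v1 _] := ownP _ A1X.
pose r A := odflt v1 [pick v | own A v].
have rP A : A \in X -> own A (r A).
  by move=> /ownP[v Av]; rewrite /r; case: pickP => [//|/(_ v)]; rewrite Av.
have rI : {in X &, injective r}.
  move=> A B AX BX rAB; have /andP[rA rA'] := rP A AX; have /andP[rB rB'] := rP B BX.
  have noprop C C' : C \in X -> r C' \in C -> own C' (r C') -> ~~ (C \proper C').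
    move=> CX rC /andP[_]; apply: contra => CC'; apply/bigcupP.
    by exists C; rewrite // inE CX.
  have nBA : ~~ (B \proper A) by apply: noprop BX _ (rP A AX); rewrite rAB.
  have nAB : ~~ (A \proper B) by apply: noprop AX _ (rP B BX); rewrite -rAB.
  case/or3P: (Xw A B AX BX) => [AB|BA|/andP[AB _]].
  - by apply/eqP; rewrite eqEproper AB.
  - by apply/esym/eqP; rewrite eqEproper BA.
  - by move/pred0Pn: AB; case; exists (r A); rewrite /= rA rAB.
rewrite -(card_in_imset rI); apply: subset_leq_card; apply/subsetP => _ /imsetP[A AX ->].
by apply/bigcupP; exists A => //; have /andP[] := rP A AX.
Qed.

Definition coverings S : {set {set {set T}}} :=
  [set X | nested X && (cover X == S)].

Definition cover_weight S : fps rat :=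
  \sum_(X in coverings S) fpsX ^+ (#|S| - #|X|).

Lemma sub_coverings S X A : X \in coverings S -> A \in X -> A \subset S.
Proof. by rewrite inE => /andP[_ /eqP<-] AX; apply: bigcup_sup. Qed.

Lemma card_coverings S X : X \in coverings S -> (#|X| <= #|S|)%N.
Proof. by rewrite inE => /andP[nX /eqP <-]; apply: card_nested. Qed.

Lemma sub_separated A B S : separated A B -> separated B A -> connected_in e S ->
  S \subset A :|: B -> (S \subset A) || (S \subset B).
Proof.
move=> /separatedP AB /separatedP BA /connected_inP Sc /subsetP SAB.
have [|SA] := boolP (S :&: A == set0).
  rewrite setI_eq0 => /pred0P SA; apply/orP; right; apply/subsetP => v vS.
  by have := SA v; have := SAB v vS; rewrite /= inE vS /= => /orP[->|].
rewrite -(Sc (S :&: A)) ?subsetIl ?subsetIr //.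
apply/separatedP => u v; rewrite !inE => /andP[uS uA] /andP[+ vS].
by have := SAB v vS; rewrite vS inE /=; case: (v \in A) => //= vB _; apply: AB.
Qed.

Lemma cover_weight0 : cover_weight set0 = 1.
Proof.
rewrite /cover_weight (big_pred1 set0) ?cards0 // => X; rewrite inE.
apply/andP/eqP => [[/nestedP[Xc _] /eqP X0]|->]; last first.
  by rewrite /cover big_set0 eqxx; split=> //; apply/nestedP; split=> A; rewrite ?inE.
apply/setP => A; rewrite inE; apply/negP => AX; have [/negP[]] := Xc _ AX.
by rewrite -subset0 -X0 bigcup_sup.
Qed.

(** Each tube is connected, hence lies in A or in B, and tubes from different sides are always
    compatible. So a covering of the union is a pair of coverings. *)
Lemma cover_weightU A B : [disjoint A & B] -> separated A B -> separated B A ->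
  cover_weight (A :|: B) = cover_weight A * cover_weight B.
Proof.
move=> dAB sAB sBA.
have disj X Y : X \in coverings A -> Y \in coverings B -> [disjoint X & Y].
  move=> XA YB; apply/pred0P => C /=; apply/negP => /andP[CX CY].
  have CA := sub_coverings XA CX; have CB := sub_coverings YB CY.
  move: XA; rewrite inE => /andP[/nestedP[/(_ C CX)[/set0Pn[v vC] _] _] _].
  by move/pred0P: dAB => /(_ v) /=; rewrite (subsetP CA) ?(subsetP CB).
have part X : X \in coverings (A :|: B) -> forall C, C \in X ->
    (C \subset A) || (C \subset B).
  move=> XAB C CX; apply: sub_separated (sub_coverings XAB CX) => //.
  by move: XAB; rewrite inE => /andP[/nestedP[/(_ C CX)[]]].
pose f (p : {set {set T}} * {set {set T}}) := p.1 :|: p.2.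
pose g X := (X :&: powerset A, X :&: powerset B).
(* The round trip [g (f p) == p] forces the members of [p.1] into A and those of [p.2] into B. *)
have eqXY p : (f p \in coverings (A :|: B)) && (g (f p) == p) =
    (p.1 \in coverings A) && (p.2 \in coverings B).
  case: p => X Y /=.
  apply/andP/andP => [[XY /eqP[gX gY]]|[XA YB]].
    have := XY; rewrite !inE /f /= => /andP[nXY /eqP cXY].
    rewrite !(nestedS _ nXY) ?subsetUl ?subsetUr //=.
    have XA : cover X \subset A.
      by apply/bigcupsP => C; rewrite -gX !inE => /andP[].
    have YB : cover Y \subset B.
      by apply/bigcupsP => C; rewrite -gY !inE => /andP[].
    have {}cXY: cover X :|: cover Y = A :|: B by rewrite -cXY /cover bigcup_setU.
    rewrite !eqEsubset XA YB; split; apply/subsetP => v vAB.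
      have: v \in cover X :|: cover Y by rewrite cXY inE vAB.
      rewrite inE => /orP[//|/(subsetP YB) vB].
      by move/pred0P: dAB => /(_ v) /=; rewrite vAB vB.
    have: v \in cover X :|: cover Y by rewrite cXY inE vAB orbT.
    rewrite inE => /orP[/(subsetP XA) vA|//].
    by move/pred0P: dAB => /(_ v) /=; rewrite vAB vA.
  have subXA C : C \in X -> C \subset A := sub_coverings XA.
  have subYB C : C \in Y -> C \subset B := sub_coverings YB.
  move: (XA); rewrite inE => /andP[/nestedP[Xc Xw] /eqP cX].
  move: (YB); rewrite inE => /andP[/nestedP[Yc Yw] /eqP cY].
  split.
    rewrite inE /f /= [cover _]bigcup_setU -!/(cover _) cX cY eqxx andbT.
    have wXY C C' : C \in X -> C' \in Y ->
        weakly_compatible e C C' /\ weakly_compatible e C' C.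
      move=> /subXA CA /subYB CB.
      have dC : [disjoint C & C'] by apply: disjointW CA CB dAB.
      rewrite /weakly_compatible dC disjoint_sym dC /=.
      split; apply/or3P; apply: Or33; apply/separatedP => u v.
        by move=> /(subsetP CA) uA /(subsetP CB) vB; apply: (separatedP _ _ sAB).
      by move=> /(subsetP CB) uA /(subsetP CA) vB; apply: (separatedP _ _ sBA).
    apply/nestedP; split=> [C|C C']; rewrite !inE; first by case/orP; auto.
    move=> /orP[CX|CY] /orP[CX'|CY']; [exact: Xw | | | exact: Yw].
      by have [] := wXY _ _ CX CY'.
    by have [] := wXY _ _ CX' CY.
  have XN C : C \in X -> C != set0 by case/Xc.
  have YN C : C \in Y -> C != set0 by case/Yc.
  have AB0 (C : {set T}) : C \subset A -> C \subset B -> C = set0.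
    move=> CA CB; apply/eqP; rewrite -subset0 -(disjoint_setI0 dAB).
    by rewrite subsetI CA.
  apply/eqP; rewrite /g /f /=; congr pair; apply/setP => C; rewrite !inE.
    have [CX|CX] := boolP (C \in X); first by rewrite subXA.
    have [CY|//] := boolP (C \in Y); apply/negP => /= CA.
    by move: (YN C CY); rewrite (AB0 C) ?eqxx ?subYB.
  have [CY|CY] := boolP (C \in Y); first by rewrite orbT subYB.
  have [CX|//] := boolP (C \in X); apply/negP => /= CB.
  by move: (XN C CX); rewrite (AB0 C) ?eqxx ?subXA.
rewrite /cover_weight big_distrlr /= pair_big_dep /=.
rewrite (reindex_onto f g) /=; last first.
  move=> X XAB; rewrite /f /g /= -setIUr; apply/setIidPl/subsetP => C CX.
  by rewrite !inE (part X).
rewrite (eq_bigl _ _ eqXY); apply: eq_bigr => -[X Y] /= /andP[XA YB].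
have cAB : #|A :|: B| = (#|A| + #|B|)%N by apply/eqP; rewrite (leq_card_setU A B).2.
have cXY : #|X :|: Y| = (#|X| + #|Y|)%N by apply/eqP; rewrite (leq_card_setU X Y).2 disj.
have XleA := card_coverings XA; have YleB := card_coverings YB.
rewrite /f /= cAB cXY -exprD; congr (_ ^+ _). by rewrite subnDA -addnBAC // -addnBA.
Qed.
End Nested.

(** * Invariance of weights under graph embeddings *)

Section Embedding.
Variables (T T' : finType) (e : rel T) (e' : rel T') (f : T -> T').
Hypotheses (fI : injective f) (ef : forall u v, e' (f u) (f v) = e u v).
Implicit Types A B S : {set T}.

Lemma preimset_imset S : f @^-1: (f @: S) = S.
Proof. by apply/setP => v; rewrite inE mem_imset. Qed.

Lemma imset_preimset S (S' : {set T'}) :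
  S' \subset f @: S -> f @: (f @^-1: S') = S'.
Proof.
move=> /subsetP S'S; apply/setP => v; apply/imsetP/idP => [[u + ->]|vS'].
  by rewrite inE.
by have /imsetP[u uS defv] := S'S v vS'; exists u; rewrite // inE -defv.
Qed.

Lemma separated_imset A B : separated e' (f @: A) (f @: B) = separated e A B.
Proof.
apply/separatedP/separatedP => AB u v.
  by move=> uA vB; rewrite -ef AB ?imset_f.
by move=> /imsetP[u' uA ->] /imsetP[v' vB ->]; rewrite ef AB.
Qed.

Lemma imsetD_inj A B : f @: (A :\: B) = f @: A :\: f @: B.
Proof.
apply/setP => v; apply/imsetP/setDP => [[u /setDP[uA uB] ->]|].
  by rewrite !mem_imset.
by case=> /imsetP[u uA ->]; rewrite mem_imset // => uB; exists u; rewrite ?inE ?uA ?uB.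
Qed.

Lemma imset_subset_inj A B : (f @: A \subset f @: B) = (A \subset B).
Proof.
apply/idP/idP; last exact: imsetS.
by move=> /(preimsetS f); rewrite !preimset_imset.
Qed.

Lemma connected_in_imset S : connected_in e' (f @: S) = connected_in e S.
Proof.
apply/connected_inP/connected_inP => Sc M MS M0 Msep.
  apply: (imset_inj fI); apply: Sc; first exact: imsetS.
    by rewrite imset_eq0.
  by rewrite -imsetD_inj separated_imset.
suff defS : f @^-1: M = S by rewrite -(imset_preimset MS) defS.
apply: Sc.
- by rewrite -imset_subset_inj (imset_preimset MS).
- by rewrite -(imset_eq0 f) (imset_preimset MS).
- by rewrite -separated_imset imsetD_inj (imset_preimset MS).
Qed.

Lemma weakly_compatible_imset A B :
  weakly_compatible e' (f @: A) (f @: B) = weakly_compatible e A B.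
Proof.
rewrite /weakly_compatible !imset_subset_inj imset_disjoint //.
by rewrite -/(separated e' _ _) -/(separated e _ _) separated_imset.
Qed.

Lemma nested_imset (X : {set {set T}}) :
  nested e' [set f @: A | A : {set T} in X] = nested e X.
Proof.
apply/nestedP/nestedP => -[Xc Xw]; split.
- move=> A AX; rewrite -(imset_eq0 f) -connected_in_imset; apply: Xc.
  exact: imset_f.
- by move=> A B AX BX; rewrite -weakly_compatible_imset; apply: Xw; apply: imset_f.
- move=> _ /imsetP[A AX ->]; rewrite imset_eq0 connected_in_imset; exact: Xc.
- by move=> _ _ /imsetP[A AX ->] /imsetP[B BX ->]; rewrite weakly_compatible_imset Xw.
Qed.

(** Members of a covering of the image lie in the image, so preimages undo images even when [f] is
    not onto. *)
Lemma cover_weight_imset S : cover_weight e' (f @: S) = cover_weight e S.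
Proof.
pose F (X : {set {set T}}) := [set f @: A | A : {set T} in X].
pose G (Y : {set {set T'}}) := [set f @^-1: A | A : {set T'} in Y].
rewrite /cover_weight (reindex_onto F G) /=; last first.
  move=> Y YS; rewrite /F /G -imset_comp -[RHS]imset_id; apply: eq_in_imset.
  by move=> A AY /=; apply: imset_preimset (sub_coverings YS AY).
apply: eq_big => [X|X _].
  rewrite !inE nested_imset cover_imset -imset_cover (inj_eq (imset_inj fI)).
  rewrite [X in _ && X](_ : _ = true) ?andbT //; apply/eqP.
  rewrite /F /G -imset_comp -[RHS]imset_id; apply: eq_imset.
  exact: preimset_imset.
by rewrite /F !card_imset //; apply: imset_inj.
Qed.
End Embedding.

(** * Subsets of a path as products of runs *)

Lemma connected_path m : connected_in (@path_adj m) [set: 'I_m].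
Proof.
have up (i j : 'I_m) : (i <= j)%N ->
    connect (induced (@path_adj m) setT) i j /\ connect (induced (@path_adj m) setT) j i.
  move=> ij; have [d dE] : exists d, (i + d = j)%N by exists (j - i)%N; rewrite subnKC.
  elim: d j dE {ij} => [|d IHd] j dE.
    by have -> : i = j by apply: val_inj; rewrite -[LHS]addn0.
  have jm : (i + d < m)%N by rewrite (leq_trans _ (ltn_ord j)) // -dE addnS.
  have [ij ji] := IHd (Ordinal jm) erefl.
  by split; [apply: connect_trans ij _|apply: connect_trans _ ji]; apply: connect1;
    rewrite /induced /path_adj /consecutive /= !inE -dE addnS eqxx ?orbT.
apply/'forall_in_forall_inP => i _ j _.
by case/orP: (leq_total i j) => /up[].
Qed.

(** The coefficients of 1 + B, by [path_weight0] and [path_weightS]. *)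
Definition path_weight m : fps rat := cover_weight (@path_adj m) [set: 'I_m].

Lemma path_weight0 : path_weight 0 = 1.
Proof.
rewrite /path_weight (_ : setT = set0) ?cover_weight0 //.
by apply/setP => -[].
Qed.

(** Product of [p] over the lengths of the maximal runs of [true], where k is the length of the run
    still open. Empty runs contribute [p 0], which is 1 for [path_weight]. *)
Fixpoint run_weight (R : pzSemiRingType) (p : nat -> R) k (s : bitseq) : R :=
  match s with
  | [::] => p k
  | true :: s' => run_weight p k.+1 s'
  | false :: s' => p k * run_weight p 0 s'
  end.

Definition bitset N (s : bitseq) : {set 'I_N} := [set i : 'I_N | nth false s i].

Lemma cover_weight_interval N a k : (a + k <= N)%N ->
  cover_weight (@path_adj N) (bitset N (nseq a false ++ nseq k true)) =
  path_weight k.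
Proof.
move=> akN.
have lt_shift (i : 'I_k) : (a + i < N)%N.
  by rewrite (leq_trans _ akN) // ltn_add2l.
pose f i := Ordinal (lt_shift i).
have fI : injective f by move=> i j [] /addnI/val_inj.
rewrite /path_weight -(@cover_weight_imset _ _ _ (@path_adj N) f) //; last first.
  by move=> i j; rewrite /path_adj /consecutive /= -!addnS !eqn_add2l.
congr cover_weight; apply/setP => i; rewrite inE nth_cat !nth_nseq size_nseq.
case: (ltnP i a) => [ia|ai].
  apply/esym/imsetP => -[j _ /(congr1 val) /= ij].
  by move: ia; rewrite ij ltnNge leq_addr.
rewrite ltn_subLR //; case: ltnP => [ik|ki]; apply/esym/imsetP.
  have ia : (i - a < k)%N by rewrite ltn_subLR.
  by exists (Ordinal ia) => //; apply: val_inj; rewrite /= subnKC.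
by case=> j _ /(congr1 val) /= ij; move: ki; rewrite ij leq_add2l leqNgt ltn_ord.
Qed.

Lemma cat_nseq_cons (U : Type) k (v : U) s :
  nseq k v ++ v :: s = v :: nseq k v ++ s.
Proof. by elim: k => //= k ->. Qed.

Lemma nth_block a k s i : nth false (nseq a false ++ nseq k true ++ s) i =
  (a <= i < a + k)%N || (a + k <= i)%N && nth false s (i - (a + k)).
Proof.
rewrite !nth_cat !nth_nseq !size_nseq subnDA.
case: (ltnP i a) => [ia|ai] /=; first by rewrite leqNgt ltn_addr.
rewrite ltn_subLR //; case: ltnP => //= ki.
Qed.

(** The prefix of a letters [false] stands for the positions already read, so that the induction
    stays inside one path on N vertices. *)
Lemma cover_weight_bitset N a k s : (a + k + size s <= N)%N ->
  cover_weight (@path_adj N) (bitset N (nseq a false ++ nseq k true ++ s)) =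
  run_weight path_weight k s.
Proof.
elim: s a k => [|[] s IHs] a k /= sN.
- by rewrite cats0 cover_weight_interval // -[leqLHS]addn0.
- rewrite -(IHs a k.+1); last by lia.
  by rewrite cat_nseq_cons.
(* Position a + k is left out, so the closed run is disjoint from and not adjacent to what
   follows. *)
have -> : bitset N (nseq a false ++ nseq k true ++ false :: s) =
    bitset N (nseq a false ++ nseq k true) :|:
    bitset N (nseq (a + k).+1 false ++ nseq 0 true ++ s).
  apply/setP => i; rewrite !inE -[nseq k true in RHS]cats0 !nth_block /= nth_nil.
  rewrite addn0 !andbF !orbF; congr (_ || _).
  rewrite (_ : (a + k < i < (a + k).+1)%N = false) /=; last by lia.
  have [ai|ai|<-] := ltngtP (a + k)%N i => //.
    by rewrite -(subnSK ai).
  by rewrite subnn.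
have blockA (i : 'I_N) : i \in bitset N (nseq a false ++ nseq k true) -> (i < a + k)%N.
  by rewrite inE -[nseq k true]cats0 nth_block nth_nil andbF orbF => /andP[].
have blockB (i : 'I_N) :
    i \in bitset N (nseq (a + k).+1 false ++ nseq 0 true ++ s) -> (a + k < i)%N.
  by rewrite inE nth_block addn0 => /orP[|]/andP[].
rewrite cover_weightU.
- rewrite cover_weight_interval; last by lia.
  by rewrite (IHs _ 0%N) //; lia.
- by apply/pred0P => i /=; apply/negP => /andP[/blockA + /blockB]; lia.
- apply/separatedP => i j /blockA ia /blockB jb.
  by rewrite /path_adj /consecutive /=; lia.
- apply/separatedP => i j /blockB ia /blockA jb.
  by rewrite /path_adj /consecutive /=; lia.
Qed.

(** * Series recurrences indexed by a shift *)

Section SeriesTheory.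
Variable R : comNzRingType.
Implicit Types (f g : fps R) (c d : R) (p : nat -> R).

Lemma coefsCM c f n : coefs (fpsC c * f) n = c * coefs f n.
Proof.
by rewrite coefsM big_ord_recl subn0 big1 ?addr0 // => i _; rewrite mul0r.
Qed.

Lemma coefsXM f n : coefs (fpsX * f) n.+1 = coefs f n.
Proof.
rewrite coefsM 2!big_ord_recl mul0r add0r mul1r subSS subn0 big1 ?addr0 //.
by move=> i _; rewrite mul0r.
Qed.

Lemma coefsXM0 f : coefs (fpsX * f) 0 = 0.
Proof. by rewrite coefsM0 mul0r. Qed.

Lemma fpsCM c d : fpsC (c * d) = fpsC c * fpsC d :> fps R.
Proof. by apply: fpsP => -[|n]; rewrite coefsCM //= mulr0. Qed.

Lemma fpsC0 : fpsC 0 = 0 :> fps R. Proof. by apply: fpsP => -[]. Qed.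

Lemma fpsC1 : fpsC 1 = 1 :> fps R. Proof. by []. Qed.

Lemma coefs_sum (I : Type) (r : seq I) (P : pred I) (F : I -> fps R) n :
  coefs (\sum_(i <- r | P i) F i) n = \sum_(i <- r | P i) coefs (F i) n.
Proof. exact: (big_morph (fun f => coefs f n)). Qed.

Lemma coefsXn m n : coefs (fpsX ^+ m : fps R) n = (n == m)%:R.
Proof.
elim: m n => [|m IHm] n; first by rewrite coefs1; case: n.
by rewrite exprS; case: n => [|n]; rewrite ?coefsXM0 ?coefsXM ?IHm.
Qed.

(** Degree n + 1 of [F i] involves only [c i] and degree n of [F i.+1], so induction on the degree
    works for all i at once. *)
Lemma fps_shift_unique (F G : nat -> fps R) (c : nat -> fps R) :
  (forall i, F i = c i + fpsX * F i.+1) -> (forall i, G i = c i + fpsX * G i.+1) ->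
  F =1 G.
Proof.
move=> FE GE i; apply: fpsP => n; elim: n i => [|n IHn] i.
  by rewrite FE GE !coefsD !coefsXM0.
by rewrite FE GE !coefsD !coefsXM IHn.
Qed.

Definition tail_gf p i : fps R := Fps (fun n => p (i + n)%N).

Lemma tail_gfE p i : tail_gf p i = fpsC (p i) + fpsX * tail_gf p i.+1.
Proof.
apply: fpsP => -[|n]; rewrite coefsD ?coefsXM0 ?coefsXM /= ?addn0 ?addr0 //.
by rewrite add0r addnS.
Qed.

(** The equation of an open run of length i: close it with factor [p i], or lengthen it by one
    letter. Solving it eliminates i. *)
Lemma tail_gf_solve p (c : fps R) (F : nat -> fps R) i :
  (forall i, F i = fpsC (p i) * c + fpsX * F i.+1) -> F i = c * tail_gf p i.
Proof.
move=> FE; apply: (fps_shift_unique (G := fun j => c * tail_gf p j) FE) => j.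
by rewrite {1}tail_gfE; ring.
Qed.
End SeriesTheory.

(** * Generating functions of words read letter by letter *)

Section Words.
Variables (R : comNzRingType) (L : finType).
Implicit Type F : seq L -> R.

Definition words_gf F : fps R := Fps (fun n => \sum_(w : n.-tuple L) F w).

Lemma eq_words_gf F G : F =1 G -> words_gf F = words_gf G.
Proof. by move=> FG; apply: fpsP => n /=; apply: eq_bigr. Qed.

Lemma words_gfZ c F : words_gf (fun w => c * F w) = fpsC c * words_gf F.
Proof. by apply: fpsP => n; rewrite coefsCM /= mulr_sumr. Qed.

Lemma words_gfE F : words_gf F =
  fpsC (F [::]) + fpsX * \sum_l words_gf (fun w => F (l :: w)).
Proof.
apply: fpsP => -[|n]; rewrite coefsD ?coefsXM0 ?coefsXM /=.
  by rewrite addr0 (big_pred1 [tuple]) // => w; apply/esym/eqP/val_inj; case: w => -[].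
rewrite add0r coefs_sum /= pair_big /=.
rewrite (reindex (fun lw : L * n.-tuple L => [tuple of lw.1 :: lw.2])) //=.
exists (fun w => (thead w, [tuple of behead w])) => [[l w] _|w _] /=.
  by congr pair; apply: val_inj.
by rewrite -tuple_eta.
Qed.
End Words.

(** The letters 0, + and - are [None], [Some false] and [Some true]. *)
Lemma letters_gfE (R : comNzRingType) (F : seq (option bool) -> R) : words_gf F =
  fpsC (F [::]) + fpsX * (words_gf (fun w => F (None :: w)) +
    words_gf (fun w => F (Some false :: w)) + words_gf (fun w => F (Some true :: w))).
Proof.
rewrite words_gfE (bigD1 None) // (bigD1 (Some false)) // (big_pred1 (Some true)) /=.
  by rewrite addrA.
by case=> [[]|].
Qed.

(** * The linear systems for the path, the twisted path and the cis double path *)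

Section RunWeight.
Variables (R : comNzRingType) (x : R) (p : nat -> R).
Hypothesis p0 : p 0 = 1.

Local Notation rw := (run_weight p).
Local Notation T := (tail_gf p).
Let z : fps R := fpsC x * fpsX.
(** For [path_weight], [T 0] is 1 + B and [fpsX * T 1] is B. *)
Let D := 1 - fpsX * T 1 - z * T 0.

Lemma tail_gf0 : T 0 = 1 + fpsX * T 1.
Proof. by rewrite tail_gfE p0. Qed.

Lemma run_weight_cat k s s' : rw k (s ++ false :: s') = rw k s * rw 0 s'.
Proof. by elim: s k => [|[] s IHs] k //=; rewrite IHs mulrA. Qed.

Lemma run_weight_nseq k a : rw k (nseq a true) = p (k + a).
Proof. by elim: a k => [|a IHa] k /=; rewrite ?addn0 // IHa addSnnS. Qed.

Definition subset_weight (s : bitseq) := x ^+ count negb s * rw 0 s.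

(** With an open run of length i, [tail_gf_solve] applies to [V i]; i = 0 then gives a linear
    equation for [V 0]. *)
Lemma subset_gf : words_gf subset_weight * (1 - z * T 0) = T 0.
Proof.
pose wt i s := x ^+ count negb s * rw i s.
pose V i := words_gf (wt i).
have VE i : V i = fpsC (p i) * (1 + z * V 0) + fpsX * V i.+1.
  have wtF s : wt i (false :: s) = (x * p i) * wt 0 s by rewrite /wt /= exprS; ring.
  rewrite {1}/V words_gfE big_bool (eq_words_gf wtF).
  by rewrite words_gfZ fpsCM {1}/wt /= mul1r /z -!/(V _); ring.
have V0 : V 0 = (1 + z * V 0) * T 0 by apply: tail_gf_solve.
by rewrite -/(V _) mulrBr mulr1 {1}V0; ring.
Qed.

Definition signs b (w : seq (option bool)) : bitseq := map (pred1 (Some b)) w.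

(** Concatenation without a gap merges a final + run with an initial - run. *)
Definition twisted_weight w :=
  x ^+ count_mem None w * rw 0 (signs false w ++ signs true w).

(** The right-hand side is the derivative of y [T 0]. One pass over the word reads both halves; the
    length of the initial - run is remembered, because it lengthens the final + run. *)
Lemma twisted_gf :
  words_gf twisted_weight * (T 0 * D) = Fps (fun n => p n *+ n.+1).
Proof.
(* Here i and j are the open + and - runs before w, and a is the initial - run, appended to the +
   half. *)
pose wt a i j w :=
  x ^+ count_mem None w * rw i (signs false w ++ nseq a true) * rw j (signs true w).
pose H a i j := words_gf (wt a i j).
have HE a i j : H a i j = fpsC (p (i + a) * p j) +
    fpsC (p i) * fpsC (p j) * z * H a 0 0 + fpsX * fpsC (p j) * H a i.+1 0
    + fpsX * fpsC (p i) * H a 0 j.+1.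
  have wtN w : wt a i j (None :: w) = (x * p i * p j) * wt a 0 0 w.
    by rewrite /wt /= exprS; ring.
  have wtP w : wt a i j (Some false :: w) = p j * wt a i.+1 0 w.
    by rewrite /wt /= add0n; ring.
  have wtM w : wt a i j (Some true :: w) = p i * wt a 0 j.+1 w.
    by rewrite /wt /= add0n; ring.
  rewrite {1}/H letters_gfE (eq_words_gf wtN) (eq_words_gf wtP) (eq_words_gf wtM).
  by rewrite {1}/wt /= mul1r run_weight_nseq !words_gfZ !fpsCM /z -!/(H _ _ _); ring.
(* [K a] and [M a] collect the multiples of [p i] in [H a i 0] and of [p j] in [H a 0 j]. The term
   [p (i + a)] is no such multiple, whence the subtraction of [T (i + a)] below. *)
pose K a := z * H a 0 0 + fpsX * H a 0 1.
pose M a := fpsC (p a) + z * H a 0 0 + fpsX * H a 1 0.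
have Hi0 a i : H a i 0 = T (i + a) + K a * T i.
  pose F i := H a i 0 - T (i + a).
  rewrite -[LHS](subrK (T (i + a))) -/(F i) addrC; congr (_ + _).
  apply: tail_gf_solve => {}i; rewrite {1}/F HE p0 mulr1 [T (i + a)]tail_gfE.
  by rewrite /F /K addSn fpsC1; ring.
have H0j a j : H a 0 j = M a * T j.
  apply: tail_gf_solve => {}j; rewrite {1}HE p0 fpsC1 add0n fpsCM /M; ring.
(* Both solutions give [H a 0 0]; comparing them eliminates [K a]. *)
have key a : M a * (T 0 * D) = T a.
  have := Hi0 a 0; rewrite H0j add0n {1}/K !H0j => E.
  have ->: M a * (T 0 * D) = M a * T 0 -
     (z * (M a * T 0) + fpsX * (M a * T 1)) * T 0 by rewrite /D; ring.
  by rewrite {1}E; ring.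
(* Now the a letters read so far are all -. The first other letter puts a [false] in the - half,
   which closes the merged run and leads to [H] with this a. *)
pose wt' a w :=
  x ^+ count_mem None w * rw 0 (signs false w ++ nseq a true ++ signs true w).
pose W a := words_gf (wt' a).
have WE a : W a = M a + fpsX * W a.+1.
  have wtN w : wt' a (None :: w) = x * wt a 0 0 w.
    by rewrite /wt' /wt /= p0 mul1r catA run_weight_cat exprS; ring.
  have wtP w : wt' a (Some false :: w) = wt a 1 0 w.
    by rewrite /wt' /wt /= add0n catA run_weight_cat mulrA.
  have wtM w : wt' a (Some true :: w) = wt' a.+1 w.
    by rewrite /wt' /= add0n p0 mul1r cat_nseq_cons.
  rewrite {1}/W letters_gfE (eq_words_gf wtN) (eq_words_gf wtP) (eq_words_gf wtM).
  rewrite {1}/wt' /= mul1r cats0 run_weight_nseq add0n.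
  by rewrite words_gfZ /M /z -!/(H _ _ _) -/(W _); ring.
rewrite -/(W 0).
(* Unrolled, this sums y^k [T (a + k)] over k, and [p (a + n)] occurs n + 1 times in degree n. *)
have : (fun a => W a * (T 0 * D)) =1 (fun a => Fps (fun n => p (a + n)%N *+ n.+1)).
  apply: (fps_shift_unique (c := fun a => T a)) => a.
    by rewrite WE mulrDl key -mulrA.
  apply: fpsP => -[|n]; rewrite coefsD ?coefsXM0 ?coefsXM /= ?addr0 //.
  by rewrite addSnnS -mulrS.
by move/(_ 0).
Qed.

(** Words starting or ending with - weigh 0 since -1 and -n are deleted; so does the empty word, as
    [fC] has its constant term apart. The inserted [false] keeps the halves unmerged. *)
Definition cis_weight w :=
  if w is l :: w' then
    if (l != Some true) && (last l w' != Some true) then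
      x ^+ count_mem None w * rw 0 (signs false w ++ false :: signs true w)
    else 0
  else 0.

Lemma cis_gf : words_gf cis_weight * (T 0 * D) = 1 - D.
Proof.
(* A word ends with a negative letter iff the negative run that is open after
   its last letter is nonempty; j is the length of that run before w. *)
pose wt i j w := if last (0 < j)%N (signs true w) then 0
  else x ^+ count_mem None w * rw i (signs false w) * rw j (signs true w).
pose H i j := words_gf (wt i j).
have HE i j : H i j = fpsC (if (0 < j)%N then 0 else p i * p j) +
    fpsC (p i) * fpsC (p j) * z * H 0 0 + fpsX * fpsC (p j) * H i.+1 0
    + fpsX * fpsC (p i) * H 0 j.+1.
  have wtN w : wt i j (None :: w) = (x * p i * p j) * wt 0 0 w.
    by rewrite /wt /= exprS; case: ifP => _; ring.
  have wtP w : wt i j (Some false :: w) = p j * wt i.+1 0 w.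
    by rewrite /wt /= add0n; case: ifP => _; ring.
  have wtM w : wt i j (Some true :: w) = p i * wt 0 j.+1 w.
    by rewrite /wt /= add0n; case: ifP => _; ring.
  rewrite {1}/H letters_gfE (eq_words_gf wtN) (eq_words_gf wtP) (eq_words_gf wtM).
  by rewrite {1}/wt /= mul1r !words_gfZ !fpsCM /z -!/(H _ _); ring.
pose K := 1 + z * H 0 0 + fpsX * H 0 1.
pose M := z * H 0 0 + fpsX * H 1 0.
have Hi0 i : H i 0 = K * T i.
  apply: (tail_gf_solve (F := fun i => H i 0)) => {}i.
  by rewrite {1}HE p0 mulr1 fpsC1 /K; ring.
have H0S j : H 0 j.+1 = M * T j.+1.
  apply: (tail_gf_solve (p := fun j => p j.+1) (F := fun j => H 0 j.+1)) => {}j.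
  by rewrite {1}HE p0 fpsC1 fpsC0 /M; ring.
have -> : words_gf cis_weight = M.
  have wtN w : cis_weight (None :: w) = x * wt 0 0 w.
    (* The default of [last] becomes the image of the first letter, as [last_map] requires. *)
    rewrite /cis_weight /wt -[(0 < 0)%N]/(pred1 (Some true) (None : option bool)).
    rewrite last_map /=; case: eqP => _; rewrite ?mulr0 // exprS.
    by rewrite p0 mul1r run_weight_cat /= p0; ring.
  have wtP w : cis_weight (Some false :: w) = wt 1 0 w.
    rewrite /cis_weight /wt -[(0 < 0)%N]/(pred1 (Some true) (Some false)).
    rewrite last_map /=; case: eqP => _; rewrite ?add0n //.
    by rewrite run_weight_cat /= p0; ring.
  have wtM w : cis_weight (Some true :: w) = 0 * wt 0 0 w by rewrite mul0r.
  rewrite letters_gfE (eq_words_gf wtN) (eq_words_gf wtP) (eq_words_gf wtM).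
  rewrite !words_gfZ fpsC0.
  by rewrite /M /z -!/(H _ _); ring.
have EK : K = 1 + z * (K * T 0) + fpsX * (M * T 1) by rewrite {1}/K Hi0 H0S.
have EM : M = z * (K * T 0) + fpsX * (K * T 1) by rewrite {1}/M !Hi0.
have MK : M = K * (1 - D) by rewrite EM /D; ring.
(* Both sides equal [1 + z * K * T 0 + fpsX * T 1 * (K + M)]. *)
have KT : K * T 0 = 1 + M * T 0.
  rewrite [in RHS]tail_gf0 mulrDr mulr1 {1}EM {1}tail_gf0 mulrDr mulr1 {1}EK.
  ring.
have KD : K * (T 0 * D) = 1.
  by rewrite -[RHS](addrK (M * T 0)) -KT MK; ring.
by rewrite MK mulrAC KD mul1r.
Qed.
End RunWeight.

(** * Face numbers of associahedra from subsets of a path *)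

Lemma simple_face_gf (U : finType) (K : {set {set U}}) n :
  {in K, forall X : {set U}, (#|X| <= n)%N} ->
  Fps (fun k => (simple_face_num K n k)%:R) = \sum_(X in K) fpsX ^+ (n - #|X|) :> fps rat.
Proof.
move=> Kn; apply: fpsP => k; rewrite coefs_sum /=.
under eq_bigr do rewrite coefsXn.
rewrite -natr_sum -big_mkcondr /= sum1dep_card /simple_face_num; congr (_%:R).
apply: eq_card => X; rewrite !inE; case: (boolP (X \in K)) => //= /Kn Xn.
by apply/eqP/eqP; lia.
Qed.

(** Sorting by the cover S splits the exponent into n - |S| and |S| - |X|. *)
Lemma sum_nested (T : finType) (e : rel T) (P : pred {set T}) n :
  (forall S, P S -> (#|S| <= n)%N) ->
  \sum_(X | nested e X && P (cover X)) fpsX ^+ (n - #|X|) =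
  \sum_(S | P S) fpsX ^+ (n - #|S|) * cover_weight e S.
Proof.
move=> Pn; rewrite (partition_big (@cover T) P) => [|X /andP[]//].
apply: eq_bigr => S PS; rewrite /cover_weight mulr_sumr.
apply: eq_big => [X|X]; rewrite ?inE.
  by case: eqP => [->|]; rewrite ?PS ?andbT ?andbF.
case/andP=> /andP[nX _] /eqP XS; rewrite -exprD; congr (_ ^+ _).
by have := card_nested nX; have := Pn _ PS; rewrite XS; lia.
Qed.

Lemma path_tubingsE m : path_tubings m =
  [set X | nested (@path_adj m) X & setT \notin X].
Proof.
apply/setP => X; rewrite !inE; apply/andP/andP => [[/forall_inP Xt Xw]|].
  split; last by apply/negP => /Xt; rewrite /path_tube properxx andbF.
  by rewrite /nested Xw andbT; apply/forall_inP => A /Xt /and3P[-> _ ->].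
case=> /andP[/forall_inP Xc Xw] XT; split=> //; apply/forall_inP => A AX.
have /andP[A0 Ac] := Xc A AX; rewrite /path_tube A0 Ac properT andbT /=.
by apply: contraNneq XT => <-.
Qed.

Lemma nested_setU1 (T : finType) (e : rel T) (X : {set {set T}}) :
  [set: T] != set0 -> connected_in e setT -> nested e X -> nested e (setT |: X).
Proof.
move=> T0 Tc /nestedP[Xc Xw]; apply/nestedP; split=> [A|A B]; rewrite !inE.
  by case/predU1P => [->|/Xc].
case/predU1P => [->|AX] /predU1P[->|BX]; last exact: Xw.
- by rewrite /weakly_compatible subsetT.
- by rewrite /weakly_compatible subsetT orbT.
- by rewrite /weakly_compatible subsetT.
Qed.

Lemma setT_ord_neq0 m : [set: 'I_m.+1] != set0.
Proof. by apply/set0Pn; exists ord0; rewrite inE. Qed.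

Lemma coveringsT (T : finType) (e : rel T) X :
  [set: T] != set0 -> connected_in e setT ->
  (X \in coverings e setT) = nested e X && (setT \in X).
Proof.
move=> T0 Tc; rewrite inE; case: (boolP (nested e X)) => //= nX.
apply/eqP/idP => [cX|TX].
  by rewrite -cX; apply: (@mem_cover_nested T e); rewrite ?cX.
by apply/eqP; rewrite eqEsubset subsetT; apply: bigcup_sup.
Qed.

(** Adding the whole path keeps X nested, so [card_nested] leaves room for one more tube. *)
Lemma card_path_tubing m X : X \in path_tubings m.+1 -> (#|X| <= m)%N.
Proof.
rewrite path_tubingsE inE => /andP[nX TX].
have := card_nested (nested_setU1 (setT_ord_neq0 m) (@connected_path m.+1) nX).
by rewrite cardsU1 TX => /leq_trans/(_ (max_card _)); rewrite card_ord ltnS.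
Qed.

Lemma coefs_fA m :
  coefs fA m = \sum_(X in path_tubings m.+1) fpsX ^+ (m - #|X|).
Proof. exact/simple_face_gf/card_path_tubing. Qed.

(** The path is connected, so its coverings are the nested families containing [setT]; deleting
    [setT] leaves the tubings. *)
Lemma path_weightS m : path_weight m.+1 = coefs fA m.
Proof.
have T0 := setT_ord_neq0 m; have Tc := @connected_path m.+1.
rewrite coefs_fA /path_weight /cover_weight cardsT card_ord.
rewrite (reindex_onto (fun Y => setT |: Y) (fun X => X :\ setT)) /=; last first.
  by move=> X; rewrite coveringsT // => /andP[_ TX]; rewrite setD1K.
have cardT (Y : {set {set 'I_m.+1}}) :
  setT \notin Y -> #|setT |: Y| = #|Y|.+1 by rewrite cardsU1 => ->.
have YE (Y : {set {set 'I_m.+1}}) :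
    (setT |: Y \in coverings (@path_adj m.+1) setT) && ((setT |: Y) :\ setT == Y) =
    (Y \in path_tubings m.+1).
  rewrite path_tubingsE [in RHS]inE coveringsT // setU11 andbT.
  apply/andP/andP => [[nY /eqP <-]|[nY TY]].
    by rewrite setD11 (nestedS _ nY) // subD1set.
  by rewrite nested_setU1 // setU1K.
apply: eq_big => Y; rewrite YE // => Yt.
by rewrite cardT ?subSS //; move: Yt; rewrite path_tubingsE inE => /andP[].
Qed.

Lemma tail_gf_path : tail_gf path_weight 1 = fA.
Proof. by apply: fpsP => n; rewrite /= add1n path_weightS. Qed.

Lemma card_bitset N (s : N.-tuple bool) : (N - #|bitset N s| = count negb s)%N.
Proof.
have -> : #|bitset N s| = count id s.
  by rewrite -sum1_card -sum1_count (big_nth false) big_mkord size_tuple;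
    apply: eq_bigl => i; rewrite inE.
by rewrite -{1}(size_tuple s) -(count_predC id) addKn.
Qed.

Lemma sum_bitset (V : nmodType) N (F : {set 'I_N} -> V) :
  \sum_S F S = \sum_(s : N.-tuple bool) F (bitset N s).
Proof.
rewrite (reindex (fun s : N.-tuple bool => bitset N s)) //.
exists (fun S : {set 'I_N} => [tuple i \in S | i < N]) => [s _|S _].
  by apply: eq_from_tnth => i; rewrite tnth_mktuple inE -tnth_nth.
by apply/setP => i; rewrite inE -tnth_nth tnth_mktuple.
Qed.

(** Counts all nested families of the path twice: by the covered set, and by whether the whole path
    is a member. *)
Lemma path_subset_gf : words_gf (subset_weight fpsX path_weight) =
  1 + (1 + varx) * (vary * fA).
Proof.
apply: fpsP => m; rewrite coefsD.
have -> : coefs (words_gf (subset_weight fpsX path_weight)) m =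
    \sum_(X | nested (@path_adj m) X && true) fpsX ^+ (m - #|X|).
  rewrite (@sum_nested _ _ xpredT) => [|S _]; last first.
    by rewrite -[leqRHS]card_ord max_card.
  rewrite sum_bitset; apply: eq_bigr => s _; rewrite card_bitset.
  rewrite /subset_weight -(@cover_weight_bitset m 0 0 s) // add0n.
  by rewrite size_tuple.
case: m => [|m].
  rewrite mulrCA coefsXM0 addr0 (big_pred1 set0) ?cards0 // => X.
  have X0 A : A \in X -> A = set0 by move=> _; apply/setP => -[].
  rewrite andbT; apply/nestedP/eqP => [[Xc _]|->]; last by split=> A; rewrite !inE.
  apply/setP => A; rewrite inE; apply/negP => AX.
  by have [/negP[]] := Xc A AX; rewrite (X0 _ AX).
rewrite mulrCA coefsXM coefs1 add0r mulrDl mul1r coefsD coefsCM.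
rewrite (bigID (fun X : {set {set 'I_m.+1}} => setT \in X)); congr (_ + _).
  rewrite -path_weightS /path_weight /cover_weight cardsT card_ord.
  apply: eq_bigl => X; rewrite coveringsT ?andbT //; first exact: setT_ord_neq0.
  exact: connected_path.
(* Families without [setT] are tubings, but their exponent is m + 1 - |X| instead of m - |X|: hence
   the factor x. *)
rewrite coefs_fA mulr_sumr path_tubingsE; apply: eq_big => X; rewrite ?inE ?andbT // => XP.
by rewrite -exprS subSn // card_path_tubing // path_tubingsE inE.
Qed.

(** * Tubings of hypercube graphs as sign words *)

Definition signset n (w : seq (option bool)) : {set pm n} :=
  [set v : pm n | nth None w v.1 == Some v.2].

Lemma card_signset n (w : n.-tuple (option bool)) :
  #|signset n w| = count (predC (pred1 None)) w.
Proof.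
rewrite -sum1_card -sum1_count (big_nth None) big_mkord size_tuple.
rewrite big_mkcond [RHS]big_mkcond /=.
under eq_bigr => v do rewrite inE.
rewrite -(pair_big xpredT xpredT
  (fun i b => if nth None w (i : 'I_n) == Some b then 1%N else 0%N)) /=.
by apply: eq_bigr => i _; rewrite big_bool; case: (nth None w i) => [[]|].
Qed.

Lemma card_signsetC n (w : n.-tuple (option bool)) :
  (n - #|signset n w|)%N = count_mem None w.
Proof.
by rewrite card_signset -{1}(size_tuple w) -(count_predC (pred1 None) w) addnK.
Qed.

Lemma card_no_opposite n (U : {set pm n}) : no_opposite U -> (#|U| <= n)%N.
Proof.
move=> /forall_inP Uno; rewrite -[leqRHS]card_ord -(@card_in_imset _ _ fst U).
  exact: max_card.
move=> [i b] [j c] /= iU jU ij; rewrite -{}ij in jU *; congr pair.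
by move: (Uno _ iU); rewrite /pm_opp /=; case: b c iU jU => [] [] // _ ->.
Qed.

(** One letter per pair {i, -i} leaves no room for both signs, so words encode exactly the sets
    without opposite vertices. *)
Lemma sum_signset (V : nmodType) n (P : pred {set pm n}) (F : {set pm n} -> V) :
  \sum_(U | no_opposite U && P U) F U =
  \sum_(w : n.-tuple (option bool) | P (signset n w)) F (signset n w).
Proof.
pose g (U : {set pm n}) (i : 'I_n) := if (i, false) \in U then Some false
  else if (i, true) \in U then Some true else None.
rewrite (reindex_onto (fun w : n.-tuple (option bool) => signset n w)
  (fun U => [tuple g U i | i < n])) => [|U /andP[/forall_inP Uno _]].
  apply: eq_bigl => w.
  have -> : no_opposite (signset n w).
    apply/forall_inP => -[i b]; rewrite !inE /= => /eqP ->.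
    by case: b.
  rewrite andTb andb_idr // => _; apply/eqP/eq_from_tnth => i.
  rewrite tnth_mktuple /g !inE /= (tnth_nth None).
  by case: (nth None w i) => [[]|].
apply/setP => -[i b]; rewrite inE nth_mktuple /g /=.
have [iF|iF] := boolP ((i, false) \in U).
  by have /negbTE iT := Uno _ iF; case: b; rewrite ?iF // -[_ \in U]iT.
by have [iT|iT] := boolP ((i, true) \in U); case: b; rewrite ?iT ?(negbTE iT) ?(negbTE iF).
Qed.

(* The negative vertices follow the positive ones after a gap of length d: d = 0
   gives the twisted path, and d = 1 the double path. *)
Definition sign_pos n d (v : pm n) : nat := if v.2 then (n + d + v.1)%N else v.1.

(** The vertices embed into a path on 2n + d vertices whose d middle ones stay uncovered. *)
Lemma cover_weight_signset n d (e : rel (pm n)) (w : n.-tuple (option bool)) :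
  (forall u v, e u v = consecutive (sign_pos d u) (sign_pos d v)) ->
  cover_weight e (signset n w) =
  run_weight path_weight 0 (signs false w ++ nseq d false ++ signs true w).
Proof.
move=> eE; have posN (v : pm n) : (sign_pos d v < n + d + n)%N.
  by rewrite /sign_pos; case: v => i [] /=; rewrite ?ltn_add2l // -addnA ltn_addr.
pose f v := Ordinal (posN v).
have fI : injective f.
  move=> [i b] [j c] /(congr1 val) /=; rewrite /sign_pos /=.
  have := ltn_ord i; have := ltn_ord j.
  case: b c => [] [] /=; [move=> _ _ /addnI/val_inj -> // | lia | lia |].
  by move=> _ _ /val_inj ->.
rewrite -(@cover_weight_imset _ _ _ (@path_adj (n + d + n)) f) //.
rewrite -(@cover_weight_bitset (n + d + n) 0 0); last first.
  by rewrite !size_cat !size_map size_nseq size_tuple; lia.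
have nthE b k : nth false (signs b w) k = (nth None w k == Some b).
  have [kn|kn] := ltnP k n; first by rewrite (nth_map None) ?size_tuple.
  by rewrite !nth_default ?size_map ?size_tuple.
congr cover_weight; apply/setP => k; rewrite inE /=.
rewrite !nth_cat size_map size_tuple size_nseq nth_nseq if_same !nthE.
apply/imsetP/idP => [[[i b]] + ->|].
  rewrite inE /= /sign_pos /=; case: b => /= wi; last by rewrite ltn_ord.
  rewrite ifF; last by lia.
  rewrite ifF; last by lia.
  by rewrite -addnA addKn addKn.
case: ltnP => kn; first by exists (Ordinal kn, false); [rewrite inE | apply: val_inj].
case: ltnP => // knd wk.
have kn' : (k - n - d < n)%N by have := ltn_ord k; lia.
exists (Ordinal kn', true); first by rewrite inE.
by apply: val_inj; rewrite /= /sign_pos /=; lia.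
Qed.

(** The conditions on V and on opposite vertices pass from the cover to each tube, so they fit the
    predicate of [sum_nested]. *)
Lemma tubingsE n (V : {set pm n}) (e : rel (pm n)) :
  tubings V e = [set X | nested e X && (no_opposite (cover X) && (cover X \subset V))].
Proof.
apply/setP => X; rewrite !inE; apply/and3P/and3P.
  case=> /forall_inP Xt Xw Xo.
  split=> //; last by apply/bigcupsP => A /Xt /and4P[].
  by rewrite /nested Xw andbT; apply/forall_inP => A /Xt /and4P[-> _ -> _].
case=> nX Xo /bigcupsP XV; have /andP[/forall_inP Xc Xw] := nX; split=> //; apply/forall_inP => A AX.
have /andP[A0 Ac] := Xc A AX; apply/and4P; split=> //; first exact: XV.
apply/forall_inP => v vA; have vX : v \in cover X by apply/bigcupP; exists A.
apply: contra (forall_inP Xo v vX) => oA; apply/bigcupP.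
by exists A.
Qed.

Lemma tubings_gf n (V : {set pm n}) (e : rel (pm n)) :
  Fps (fun k => (simple_face_num (tubings V e) n k)%:R) =
  \sum_(w : n.-tuple (option bool) | signset n w \subset V)
    fpsX ^+ count_mem None w * cover_weight e (signset n w) :> fps rat.
Proof.
rewrite simple_face_gf => [|X]; last first.
  rewrite tubingsE inE => /and3P[nX Xo _].
  exact: leq_trans (card_nested nX) (card_no_opposite Xo).
rewrite tubingsE; under eq_bigl do rewrite inE.
rewrite (@sum_nested _ _ (fun U => no_opposite U && (U \subset V))); last first.
  by move=> S /andP[/card_no_opposite].
rewrite sum_signset; apply: eq_bigr => w _.
by rewrite card_signsetC.
Qed.

Lemma fTP_words : fTP = words_gf (twisted_weight fpsX path_weight).
Proof.
apply: fpsP => n; rewrite [LHS]tubings_gf; apply: eq_big => [w|w _].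
  by rewrite subsetT.
by rewrite (@cover_weight_signset n 0) // => u v; rewrite /sign_pos addn0.
Qed.

Lemma fC_words : fC = 1 + words_gf (cis_weight fpsX path_weight).
Proof.
congr (1 + _); apply: fpsP => -[|n].
  apply: fpsP => k /=; rewrite big1 // => w _; by rewrite tuple0.
rewrite [LHS]tubings_gf [RHS]/= big_mkcond; apply: eq_bigr => w _.
rewrite (@cover_weight_signset n.+1 1) => [|u v]; last first.
  rewrite /double_path /sign_pos /=.
  case: u v => i [] [j []] /=; rewrite /consecutive /= ?eqxx /=;
    have := ltn_ord i; have := ltn_ord j; lia.
case: w => -[|l w] //= lw.
have /eqP wn : size w == n by rewrite -eqSS.
have lastE : last l w = nth None (l :: w) n.
  by rewrite (last_nth None) wn.
rewrite lastE; set w' := l :: w; rewrite -[l != _]/(nth None w' 0 != _).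
suff -> : (signset n.+1 w' \subset cis_vertices n.+1) =
  (nth None w' 0 != Some true) && (nth None w' n != Some true).
  by case: ifP => //; rewrite mulrA.
apply/subsetP/andP => [wV|[w0 wN] [i b]].
  split; apply/negP => wi.
    by have := wV (ord0, true); rewrite !inE /= => /(_ wi).
  by have := wV (ord_max, true); rewrite !inE /= eqxx orbT => /(_ wi).
rewrite !inE /= => wi; case: b wi => //= wi; apply/norP; split.
  by apply: contraNneq w0 => <-.
by apply: contraNneq wN => -[<-].
Qed.

(** * Derivative, specialization at x = 0, and the equation for B *)

Lemma fps_derivM (R : comNzRingType) (f g : fps R) :
  fps_deriv (f * g) = fps_deriv f * g + f * fps_deriv g.
Proof.
(* The product rule comes from polynomials; truncation goes one degree further because the
   derivative loses one. *)
have trunc_deriv n (h : fps R) : (fps_trunc n.+1 h)^`() = fps_trunc n (fps_deriv h).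
  by apply/polyP => i; rewrite coef_deriv !coef_poly ltnS; case: ifP => // _; rewrite mul0rn.
have trunc_le n m (h k : fps R) : (n <= m)%N ->
    coefs (h * k) n = (fps_trunc n h * fps_trunc m k)`_n.
  move=> nm; rewrite (coefs_mul_trunc _ _ (leqnn n)) !coefM; apply: eq_bigr => j _.
  by rewrite !coef_poly !ltnS leq_subr (leq_trans (leq_subr _ _) nm).
apply: fpsP => n; rewrite coefsD -[LHS]/(coefs (f * g) n.+1 *+ n.+1).
rewrite (trunc_le _ _ _ _ (leqnn _)) -coef_deriv derivM coefD !trunc_deriv.
by rewrite [fps_trunc n.+1 f * _]mulrC [f * _]mulrC !(trunc_le _ _ _ _ (leqnSn n)).
Qed.

Lemma coefsMn (R : zmodType) (f : fps R) m n : coefs (f *+ m) n = coefs f n *+ m.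
Proof. by elim: m => // m IHm; rewrite !mulrS coefsD IHm. Qed.

Lemma at_x0D f g : at_x0 (f + g) = at_x0 f + at_x0 g. Proof. by []. Qed.
Lemma at_x0N f : at_x0 (- f) = - at_x0 f. Proof. by []. Qed.
Lemma at_x01 : at_x0 1 = 1. Proof. by apply: fpsP => -[]. Qed.
Lemma at_x0M f g : at_x0 (f * g) = at_x0 f * at_x0 g.
Proof.
by apply: fpsP => n; rewrite /= coefs_sum; apply: eq_bigr => i _; rewrite coefsM0.
Qed.
Lemma at_x0_varx : at_x0 varx = 0. Proof. by apply: fpsP => -[]. Qed.
Lemma at_x0_vary : at_x0 vary = fpsX. Proof. by apply: fpsP => -[|[]]. Qed.
Lemma at_x0_deriv f : at_x0 (fps_deriv f) = fps_deriv (at_x0 f).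
Proof. by apply: fpsP => n; rewrite /= coefsMn. Qed.
Definition at_x0E :=
  (at_x0D, at_x0N, at_x01, at_x0M, at_x0_varx, at_x0_vary, at_x0_deriv).

Lemma varx_lreg : GRing.lreg varx.
Proof.
have coefs_varxM h n k : coefs (coefs (varx * h) n) k.+1 = coefs (coefs h n) k.
  by rewrite coefsCM coefsXM.
by move=> f g fg; apply: fpsP => n; apply: fpsP => k; rewrite -(coefs_varxM f) fg coefs_varxM.
Qed.

(** Comparing [subset_gf] with [path_subset_gf] gives this equation times x, and x is cancelled. *)
Lemma fA_eq (B := vary * fA) : B = vary * (1 + B) * (1 + (1 + varx) * B).
Proof.
apply: varx_lreg.
have := subset_gf fpsX path_weight; rewrite path_subset_gf.
rewrite tail_gf0 ?path_weight0 // tail_gf_path -/varx -/vary -/B => /eqP.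
rewrite -subr_eq0 => /eqP E; apply/eqP; rewrite -subr_eq0 -E; apply/eqP; ring.
Qed.

(** * The closed formula and the vertex count *)

Section FinalIdentities.
Let B := vary * fA.
Let D := 1 - B - varx * vary * (1 + B).
Let Q := 1 + vary * (2 * fA + vary * fps_deriv fA).

(** [Q] is (y (1 + B))': in degree n + 1 both have n + 2 times coefficient n of [fA]. *)
Lemma fTP_eq : fTP * ((1 + B) * D) = Q.
Proof.
have := twisted_gf fpsX path_weight0.
rewrite -fTP_words tail_gf0 ?path_weight0 // tail_gf_path -/varx -/vary -/B -/D => ->.
apply: fpsP => -[|n]; first by rewrite coefsD coefsXM0 addr0 /= path_weight0.
rewrite coefsD coefsXM coefs1 add0r coefsD mulr_natl coefsMn -path_weightS.
case: n => [|n]; first by rewrite coefsXM0 addr0.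
by rewrite coefsXM -[coefs (fps_deriv _) _]/(coefs fA n.+1 *+ n.+1) -path_weightS -mulrnDr.
Qed.

Lemma fC_eq : (fC - 1) * ((1 + B) * D) = 1 - D.
Proof.
have := cis_gf fpsX path_weight0.
rewrite tail_gf0 ?path_weight0 // tail_gf_path -/varx -/vary -/B -/D => <-.
by rewrite fC_words [1 + _]addrC addrK.
Qed.

Lemma denominator_eq :
  (1 - varx * vary) * (1 + vary * fA) - 2 * vary * fA = D.
Proof. rewrite /D /B; ring. Qed.

Lemma coefs_vary0 f : coefs (vary * f) 0 = 0.
Proof. exact: coefsXM0. Qed.

(** Times (1 + B) D, the first factor is (1 + B) D + xy (1 + B) + B (1 - D) = D + B + xy (1 + B) =
    1. *)
Lemma fTP_formula :
  fTP = (1 + varx * vary / D + B * (fC - 1)) * Q.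
Proof.
have DU : D \is a GRing.unit by rewrite -denominator_eq fTP_denominator_unit.
have BU : 1 + B \is a GRing.unit by rewrite fps_unitE coefsD coefs_vary0 addr0 unitr1.
have U : (1 + B) * D \is a GRing.unit by rewrite unitrM BU.
apply: (mulIr U); rewrite fTP_eq mulrAC -[LHS]mul1r; congr (_ * _).
rewrite mulrDl -[B * _ * _]mulrA fC_eq mulrDl.
rewrite (_ : varx * vary / D * ((1 + B) * D) = varx * vary * (1 + B)).
  by rewrite /D; ring.
by rewrite [(1 + B) * D]mulrC mulrA divrK.
Qed.

Lemma fTP_vertices : at_x0 fTP =
  (1 - 2 * fpsX + fps_sqrt (1 - 4 * fpsX)) / (2 * (1 - 4 * fpsX)).
Proof.
pose X : fps rat := fpsX.
have [b bdef] : exists b, b = X * at_x0 fA by eexists.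
(* So 1 + b is the Catalan series. *)
have bE : b = X * (1 + b) ^+ 2.
  by have := congr1 at_x0 fA_eq; rewrite !at_x0E -/X -bdef => {1}->; ring.
have b0 : coefs b 0 = 0 by rewrite bdef; apply: coefsXM0.
(* Up to sign the derivative in b of the quadratic X (1 + b)^2 - b, so its square is the
   discriminant 1 - 4X. *)
pose r := 1 - 2 * X * (1 + b).
have r2 : r ^+ 2 = 1 - 4 * X.
  rewrite (_ : r ^+ 2 = 1 - 4 * X + 4 * X * (X * (1 + b) ^+ 2 - b)); last by rewrite /r; ring.
  by rewrite -bE subrr mulr0 addr0.
have rE : fps_sqrt (1 - 4 * X) = r.
  apply/esym/fps_sqrt_unique => //.
  by rewrite /r -mulrA mulrCA coefsD coefsN coefsXM0 oppr0 addr0.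
have dX : fps_deriv X = 1 by apply: fpsP => -[|[|n]] //=; rewrite mul0rn.
have d1b : fps_deriv (1 + b) = fps_deriv b.
  by apply: fpsP => n; rewrite /= add0r.
(* Differentiating [bE] gives b' r = (1 + b)^2; multiplying by X gives b again. *)
have db : X * fps_deriv b * r = b.
  have : fps_deriv b = (1 + b) ^+ 2 + 2 * X * (1 + b) * fps_deriv b.
    by rewrite {1}bE expr2 !fps_derivM dX d1b; ring.
  move/(congr1 ( *%R X)); rewrite mulrDr -bE => /eqP.
  rewrite -subr_eq => /eqP {2}<-; rewrite /r; ring.
have Q0 : at_x0 Q = 1 + b + X * fps_deriv b.
  have -> : fps_deriv b = at_x0 fA + X * fps_deriv (at_x0 fA).
    by rewrite bdef fps_derivM dX mul1r.
  by rewrite /Q mulr_natl !at_x0E -/X bdef; ring.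
have D0 : at_x0 D = 1 - b by rewrite /D /B !at_x0E -/X -bdef; ring.
have U : (1 + b) * (1 - b) \is a GRing.unit.
  by rewrite fps_unitE coefsM0 !coefsD coefsN b0 oppr0 !addr0 mulr1 unitr1.
have fE : at_x0 fTP * ((1 + b) * (1 - b)) = 1 + b + X * fps_deriv b.
  by rewrite -Q0 -fTP_eq 2!at_x0M D0 /B !at_x0E bdef.
apply: (mulIr U); rewrite fE mulrAC.
apply: (canRL (mulrK vertex_denominator_unit)).
rewrite -/X rE -r2.
apply/eqP; rewrite -subr_eq0; apply/eqP.
(* The difference of the two sides is an explicit combination of the relations [db] and [bE]. *)
have -> : (1 + b + X * fps_deriv b) * (2 * r ^+ 2) -
    (1 - 2 * X + r) * ((1 + b) * (1 - b)) =
    2 * r * (X * fps_deriv b * r - b) + 2 * (b + 2 - 4 * X * (1 + b)) * (b - X * (1 + b) ^+ 2).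
  rewrite /r; ring.
by rewrite db -bE !subrr !mulr0 addr0.
Qed.
End FinalIdentities.

Theorem proposition6p1p28 :
  fTP = (1 + varx * vary
               / ((1 - varx * vary) * (1 + vary * fA) - 2 * vary * fA)
           + vary * fA * (fC - 1))
        * (1 + vary * (2 * fA + vary * fps_deriv fA))
  /\ at_x0 fTP =
       (1 - 2 * fpsX + fps_sqrt (1 - 4 * fpsX)) / (2 * (1 - 4 * fpsX)).
Proof.
by split; [rewrite denominator_eq; apply: fTP_formula | apply: fTP_vertices].
Qed.
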